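(* Let $K$ be a (Hausdorff) compactification of the discrete set $\mathbb{N}$. Then $m(C(K))=\omega$.
   Context: A compactification of the discrete space $\mathbb{N}$ is a compact Hausdorff space $K$ containing $\mathbb{N}$, with its discrete topology, as a dense subspace. $C(K)$ is the Banach space of continuous real functions on $K$ with the supremum norm. A subset $S$ of a metric space $(M,d)$ is equilateral if there is $\lambda>0$ with $d(x,y)=\lambda$ for all distinct $x,y\in S$. An equilateral set $A\subseteq M$ is maximal if there is no equilateral set $B\subseteq M$ with $A\subsetneq B$. $m(M)=\min\{|A|: A \text{ is a maximal equilateral set in } M\}$ (a cardinal). A normed space is regarded as a metric space via its norm. *)

(* Defs.v *)
From HB Require Import structures.
From mathcomp Require Import all_boot all_order all_algebra.
From mathcomp Require Import all_classical all_reals all_analysis.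

Set Implicit Arguments.
Unset Strict Implicit.
Unset Printing Implicit Defensive.

Import Order.TTheory GRing.Theory Num.Theory.
Import numFieldNormedType.Exports.

Local Open Scope classical_set_scope.
Local Open Scope card_scope.
Local Open Scope ring_scope.

HB.mixin Record isCompactHausdorff K & Topological K := {
  compactT : compact [set: K];
  hausdorffT : hausdorff_space K
}.

#[short(type="compactHausdorffType")]
HB.structure Definition CompactHausdorff :=
  {K of Topological K & isCompactHausdorff K}.

Definition topological_embedding (X Y : topologicalType) (f : X -> Y) : Prop :=
  injective f /\
  forall U : set X, open U <-> exists2 V : set Y, open V & U = f @^-1` V.

(* [nat] carries the discrete topology (it is a [discreteTopologicalType]). *)
Definition compactification_of_nat (K : compactHausdorffType) (i : nat -> K)
  : Prop := topological_embedding i /\ dense (range i).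

(* An alias is needed because [continuousType] itself already carries the
   compact-open topology. *)
Definition CK (K : compactHausdorffType) (R : realType) : Type :=
  continuousType K R.

Section CK_normed.
Context {K : compactHausdorffType} {R : realType}.
Implicit Types (f g h : CK K R).

HB.instance Definition _ := Choice.on (CK K R).

Definition CK_fun f : K -> R := @Continuous.sort K R f.
Local Coercion CK_fun : CK >-> Funclass.

Lemma CK_continuous f : continuous (f : K -> R).
Proof. exact: (@cts_fun _ _ f). Qed.

Definition mkCK (u : K -> R) (cu : continuous u) : CK K R :=
  HB.pack_for (continuousType K R) u (isContinuous.Build K R u cu).

Lemma CKP f g : (f : K -> R) =1 g -> f = g.
Proof. by move=> fg; apply/continuousEP. Qed.

Let zeroP : continuous (fun _ : K => 0 : R).
Proof. by move=> x; apply: cvg_cst. Qed.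
Let oppP f : continuous (fun x => - f x).
Proof. by move=> x; apply: cvgN; exact: CK_continuous. Qed.
Let addP f g : continuous (fun x => f x + g x).
Proof. by move=> x; apply: cvgD; exact: CK_continuous. Qed.
Let scaleP (a : R) f : continuous (fun x => a * f x).
Proof. by move=> x; apply: cvgMr; exact: CK_continuous. Qed.

Definition CK_zero : CK K R := mkCK zeroP.
Definition CK_opp f : CK K R := mkCK (@oppP f).
Definition CK_add f g : CK K R := mkCK (@addP f g).
Definition CK_scale (a : R) f : CK K R := mkCK (@scaleP a f).

Let addA : associative CK_add.
Proof. by move=> f g h; apply: CKP => x /=; exact: addrA. Qed.
Let addC : commutative CK_add.
Proof. by move=> f g; apply: CKP => x /=; exact: addrC. Qed.
Let add0 : left_id CK_zero CK_add.
Proof. by move=> f; apply: CKP => x /=; exact: add0r. Qed.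
Let addN : left_inverse CK_zero CK_opp CK_add.
Proof. by move=> f; apply: CKP => x /=; exact: addNr. Qed.

HB.instance Definition _ := GRing.isZmodule.Build (CK K R) addA addC add0 addN.

Let scaleA a b f : CK_scale a (CK_scale b f) = CK_scale (a * b) f.
Proof. by apply: CKP => x /=; exact: mulrA. Qed.
Let scale1 : left_id 1 CK_scale.
Proof. by move=> f; apply: CKP => x /=; exact: mul1r. Qed.
Let scaleDr : right_distributive CK_scale +%R.
Proof. by move=> a f g; apply: CKP => x /=; exact: mulrDr. Qed.
Let scaleDl f : {morph CK_scale^~ f : a b / a + b}.
Proof. by move=> a b; apply: CKP => x /=; exact: mulrDl. Qed.

HB.instance Definition _ := GRing.Zmodule_isLmodule.Build R (CK K R)
  scaleA scale1 scaleDr scaleDl.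

(* If [K] is empty this is [sup set0 = 0], the norm of the trivial space. *)
Definition sup_norm f : R := sup (range (fun x : K => `|f x|)).

Lemma CK_bounded f : has_ubound (range (fun x : K => `|f x|)).
Proof.
have cf : continuous (fun x : K => `|f x|).
  by move=> x; apply: cvg_norm; exact: CK_continuous.
have /compact_bounded : compact (range (fun x : K => `|f x|)).
  apply: continuous_compact compactT.
  exact: continuous_subspaceT.
move=> [M [Mr HM]]; exists (M + 1) => y yf.
apply: le_trans (ler_norm _) _.
by apply: (HM (M + 1)) => //; rewrite ltrDl.
Qed.

Lemma sup_norm_ub f x : `|f x| <= sup_norm f.
Proof. by apply: ub_le_sup; [exact: CK_bounded | exists x]. Qed.

Lemma sup_norm_le f (M : R) : 0 <= M -> (forall x, `|f x| <= M) ->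
  sup_norm f <= M.
Proof.
move=> M0 fM; rewrite /sup_norm.
have [->|/set0P ne] := eqVneq (range (fun x : K => `|f x|)) set0.
  by rewrite sup0.
by apply: ge_sup => // _ [x _ <-].
Qed.

Lemma sup_norm_ge0 f : 0 <= sup_norm f.
Proof.
rewrite /sup_norm.
have [->|/set0P[_ [x _ _]]] := eqVneq (range (fun x : K => `|f x|)) set0.
  by rewrite sup0.
exact: le_trans (sup_norm_ub f x).
Qed.

Let normD f g : sup_norm (f + g) <= sup_norm f + sup_norm g.
Proof.
apply: sup_norm_le => [|x]; first by rewrite addr_ge0 ?sup_norm_ge0.
by apply: le_trans (ler_normD _ _) _; rewrite lerD ?sup_norm_ub.
Qed.

Let normZ_le (a : R) f : sup_norm (a *: f) <= `|a| * sup_norm f.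
Proof.
apply: sup_norm_le => [|x]; first by rewrite mulr_ge0 ?sup_norm_ge0.
by rewrite [`|_|]normrM ler_wpM2l ?sup_norm_ub.
Qed.

Let normZ (a : R) f : sup_norm (a *: f) = `|a| * sup_norm f.
Proof.
apply/eqP; rewrite eq_le normZ_le /=.
have [->|a0] := eqVneq a 0; first by rewrite normr0 mul0r sup_norm_ge0.
rewrite -ler_pdivlMl ?normr_gt0//.
by have := normZ_le a^-1 (a *: f); rewrite scalerA mulVf// scale1r normfV.
Qed.

Let norm0_eq0 f : sup_norm f = 0 -> f = 0.
Proof.
move=> f0; apply: CKP => x; apply/normr0_eq0/le_anti.
by rewrite normr_ge0 andbT -f0 sup_norm_ub.
Qed.

HB.instance Definition _ := Lmodule_isNormed.Build R (CK K R)
  normD normZ norm0_eq0.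

Let dist f g : R := `|f - g|.
Let dist_ge0 f g : 0 <= dist f g. Proof. exact: normr_ge0. Qed.
Let dist_eq0 f g : dist f g = 0 -> f = g.
Proof. by move/normr0_eq0/subr0_eq. Qed.
Let ballE f (e : R) : ball f e = [set g | dist f g < e].
Proof. by rewrite -ball_normE. Qed.

HB.instance Definition _ :=
  PseudoMetric_isMetric.Build R (CK K R) dist_ge0 dist_eq0 ballE.

Lemma CK_mdistE f g : mdist f g = sup (range (fun x : K => `|f x - g x|)).
Proof. by []. Qed.

End CK_normed.

Coercion CK_fun : CK >-> Funclass.

Section equilateral.
Context {R : realType} (M : metricType R).

Definition equilateral (S : set M) : Prop :=
  exists2 lambda : R, 0 < lambda &
    forall x y, S x -> S y -> x <> y -> mdist x y = lambda.

Definition maximal_equilateral (A : set M) : Prop :=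
  equilateral A /\ ~ exists2 B, equilateral B & A `<` B.

(* [m(M) = #|kappa|]: the least cardinality of a maximal equilateral set,
   cardinals being represented by arbitrary sets up to equipotence. *)
Definition m_is (T : Type) (kappa : set T) : Prop :=
  (exists2 A, maximal_equilateral A & A #= kappa) /\
  (forall A, maximal_equilateral A -> kappa #<= A).

End equilateral.

(* Main.v *)
Require Import Defs.
From mathcomp Require Import all_boot all_order all_algebra.
From mathcomp Require Import all_classical all_reals all_analysis.
From mathcomp Require Import lra.

(* A finite equilateral set in [C(K)], [K] infinite, extends: Urysohn's lemma
   interpolates between the extreme admissible functions so as to attain each of
   the finitely many prescribed distances at some point.  So a maximal
   equilateral set is infinite.  Conversely, the points of the dense copy of the
   naturals are isolated, so the functions [f_n] equal to [-1] on [{0,...,n-1}],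
   to [1] at [n] and to [0] elsewhere are continuous; they are at mutual distance
   [2], and the constant [-1] is the only function at distance [2] from all. *)

Import Order.TTheory GRing.Theory Num.Theory.
Import numFieldNormedType.Exports.

Local Open Scope classical_set_scope.
Local Open Scope ring_scope.

(** Both [M - l] and [m + l] lie in the interval [[h - l, h + l]], which is convex. *)
Lemma convex_dist_le (R : realFieldType) (u l m M h : R) :
  0 <= u -> u <= 1 -> m <= h -> h <= M -> M - m <= l ->
  `|(1 - u) * (M - l) + u * (m + l) - h| <= l.
Proof. by move=> u0 u1 mh hM Mm; rewrite ler_norml; apply/andP; split; nra. Qed.

(** * Supremum distance and extension of finite equilateral sets *)

Section sup_metric.
Context {K : compactHausdorffType} {R : realType}.
Implicit Types f g : CK K R.

Lemma CK_mdist_ub f g x : `|f x - g x| <= mdist f g.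
Proof. exact: (@sup_norm_ub K R (f - g) x). Qed.

Lemma CK_mdist_le f g c : 0 <= c -> (forall x, `|f x - g x| <= c) ->
  mdist f g <= c.
Proof. exact: (@sup_norm_le K R (f - g) c). Qed.

Lemma CK_mdist_attained (x0 : K) f g : exists x, `|f x - g x| = mdist f g.
Proof.
have K0 : [set: K] !=set0 by exists x0.
have cfg : {within [set: K], continuous (fun x => `|f x - g x|)}.
  apply: continuous_subspaceT => x; apply: cvg_norm.
  by apply: cvgB; exact: CK_continuous.
have [x _ xmax] := compact_EVT_max K0 compactT cfg.
exists x; apply/le_anti; rewrite CK_mdist_ub /=.
by apply: CK_mdist_le => // y; apply: xmax; rewrite inE.
Qed.

Lemma CK_mdist_le_dense (D : set K) f g c : dense D -> 0 <= c ->
  (forall x, D x -> `|f x - g x| <= c) -> mdist f g <= c.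
Proof.
move=> dD c0 fgc; apply: CK_mdist_le => // x; rewrite leNgt; apply/negP => cx.
have oU : open ((fun y => `|f y - g y|) @^-1` [set z | c < z]).
  apply: open_comp; last exact: open_gt.
  by move=> y _; apply: cvg_norm; apply: cvgB; exact: CK_continuous.
have [y [/= cy Dy]] := dD _ (ex_intro _ x cx) oU.
by have := fgc y Dy; rewrite leNgt cy.
Qed.

(** As [M x] is the value of some member at [x], bounds on distances between members pass to the
    envelopes. *)
Lemma finite_upper_envelope f (s : seq (CK K R)) :
  exists2 M : K -> R, continuous M &
    (forall (h : CK K R) x, h \in f :: s -> h x <= M x) /\
    (forall x, exists2 h : CK K R, h \in f :: s & M x = h x).
Proof.
elim: s => [|h s [M cM [ubM exM]]].
  exists (f : K -> R); first exact: CK_continuous.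
  split=> [h x|x]; first by rewrite inE => /eqP ->.
  by exists f; rewrite ?mem_head.
exists (fun x => Num.max (h x) (M x)).
  move=> x; apply: (@continuous_max R K h M x); last exact: cM.
  exact: CK_continuous.
split=> [k x|x].
  rewrite !inE orbCA le_max => /orP[/eqP ->|ks]; first by rewrite lexx.
  by rewrite ubM ?orbT// inE.
case: (leP (h x) (M x)) => _; last first.
  by exists h => //; rewrite !inE eqxx orbT.
have [k ks ->] := exM x; exists k => //.
by move: ks; rewrite !inE orbCA => ->; rewrite orbT.
Qed.

Lemma finite_lower_envelope f (s : seq (CK K R)) :
  exists2 m : K -> R, continuous m &
    (forall (h : CK K R) x, h \in f :: s -> m x <= h x) /\
    (forall x, exists2 h : CK K R, h \in f :: s & m x = h x).
Proof.
have [M cM [ubM exM]] := finite_upper_envelope (- f) (map -%R s).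
exists (fun x => - M x); first by move=> x; apply: cvgN; exact: cM.
split=> [h x hs|x].
  by rewrite lerNl; apply: (ubM (- h)); rewrite -map_cons map_f.
have [_ /mapP[h hs ->] Mx] : exists2 h : CK K R, h \in map -%R (f :: s) & M x = h x.
  exact: exM.
by exists h => //; rewrite Mx; exact: opprK.
Qed.

(** Finite sets are closed here, and a compact Hausdorff space is normal. *)
Lemma finite_Urysohn {A B : set K} : finite_set A -> finite_set B ->
  A `&` B = set0 -> exists u : K -> R,
    [/\ continuous u, forall x, 0 <= u x <= 1, forall x, A x -> u x = 0 &
        forall x, B x -> u x = 1].
Proof.
have cl := accessible_finite_set_closed.1 (hausdorff_accessible (@hausdorffT K)).
move=> /cl cA /cl cB AB0.
have [u [cu u0 u1 u01]] := urysohn_ext_itv (compact_normal hausdorffT compactT)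
  cA cB AB0 (@ltr01 R).
exists u; split=> // x.
- by have /= := u01 (u x) (ex_intro2 _ _ x I erefl); rewrite in_itv.
- by move=> Ax; apply: u0; exists x.
- by move=> Bx; apply: u1; exists x.
Qed.

(* At every point an admissible [g] lies between [M - lambda] and [m + lambda],
   [M] and [m] being the envelopes of the given functions.  Fix [j] with
   [j y = M y] at a point [y] where no distance between two given functions is
   attained.  Any other [f] is at distance [lambda] from [j] at some point [x];
   there [f] is an envelope, and choosing [g x] on the far side of [j] attains
   the distance to [f], whereas [g y = M y - lambda] attains the one to [j]. *)
Lemma finite_equilateral_extend (lambda : R) f (s : seq (CK K R)) :
  infinite_set [set: K] -> 0 < lambda ->
  {in f :: s &, forall h k : CK K R, h <> k -> mdist h k = lambda} ->
  exists g, forall h : CK K R, h \in f :: s -> mdist g h = lambda.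
Proof.
move=> infK l0 eqs; set S := f :: s in eqs *.
have /infinite_setN0[x0 _] := infK.
have [w wP] := choice (fun p : CK K R * CK K R =>
  CK_mdist_attained x0 p.1 p.2).
pose W := w @` [set p | p \in [seq (h, k) | h <- S, k <- S]].
have finW : finite_set W by apply: finite_image; exact: finite_seq.
have [y Wy] : exists y, ~ W y.
  apply/existsNP => WT; apply: infK; apply: sub_finite_set finW.
  by move=> x _; exact: WT.
have [M cM [Mub Mex]] := finite_upper_envelope f s.
have [m cm [mlb mex]] := finite_lower_envelope f s.
have Mm x : M x - m x <= lambda.
  have [h hS ->] := Mex x; have [k kS ->] := mex x.
  have [->|/eqP hk] := eqVneq h k; first by rewrite subrr ltW.
  by rewrite -(eqs h k hS kS hk) (le_trans (ler_norm _))// CK_mdist_ub.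
have [j jS Mj] := Mex y.
(* [u] will be [0] on [A], making [g0] equal to [M - lambda] there, and [1] on [B], making it
   [m + lambda]. *)
pose A := y |` (W `&` [set x | M x = j x + lambda]).
pose B := W `&` [set x | m x = j x - lambda].
have finA : finite_set A.
  by rewrite /A finite_setU; split; [exact: finite_set1|exact: finite_setIl].
have finB : finite_set B by exact: finite_setIl.
have AB0 : A `&` B = set0.
  (* A common point is in [W], so it is not [y], and there [M x - m x] would be [2 * lambda]. *)
  apply/seteqP; split=> // x [Ax [/= Wx mx]].
  case: Ax => [xy|[_ /= Mx]]; first by apply: Wy; rewrite -xy.
  by have := Mm x; rewrite Mx mx; lra.
have [u [cu u01 u0 u1]] := finite_Urysohn finA finB AB0.
pose g0 x := (1 - u x) * (M x - lambda) + u x * (m x + lambda).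
have cg0 : continuous g0.
  move=> x; apply: cvgD; apply: cvgM.
  - by apply: cvgB; [exact: cvg_cst|exact: cu].
  - by apply: cvgB; [exact: cM|exact: cvg_cst].
  - exact: cu.
  - by apply: cvgD; [exact: cm|exact: cvg_cst].
exists (mkCK cg0) => h hS.
suff [x gx] : exists x, `|g0 x - h x| = lambda.
  apply/le_anti/andP; split; last first.
    by rewrite -{1}gx; exact: (CK_mdist_ub (mkCK cg0) h x).
  apply: CK_mdist_le (ltW l0) _ => z.
  have := Mm z; have := Mub h z hS; have := mlb h z hS.
  have /andP[uz0 uz1] := u01 z => mh hM Mmz.
  exact: (@convex_dist_le R (u z) lambda (m z) (M z) (h z)).
have [->|/eqP hj] := eqVneq h j.
  exists y; rewrite /g0 u0; last by left.
  by rewrite Mj subr0 mul1r mul0r addr0 addrC addKr normrN gtr0_norm.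
exists (w (h, j)); set x := w (h, j).
have Wx : W x.
  by exists (h, j) => //; exact: allpairs_f.
have := wP (h, j); rewrite /= -/x (eqs _ _ hS jS hj) => hjx.
have := Mm x; have := Mub h x hS; have := mlb h x hS.
have := Mub j x jS; have := mlb j x jS => mj jM mh hM Mmx.
(* [h x] and [j x] differ by [lambda] while [M x - m x <= lambda], so the larger is [M x] and the
   smaller [m x]. *)
have [jh|hj0] := leP (j x) (h x).
  move: hjx; rewrite ger0_norm ?subr_ge0// => hjx.
  have Mx : M x = j x + lambda by lra.
  rewrite /g0 u0; last by right.
  have -> : (1 - 0) * (M x - lambda) + 0 * (m x + lambda) - h x = - lambda.
    by lra.
  by rewrite normrN gtr0_norm.
move: hjx; rewrite ltr0_norm ?subr_lt0// => hjx.
have mx : m x = j x - lambda by lra.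
rewrite /g0 u1; last by split.
have -> : (1 - 1) * (M x - lambda) + 1 * (m x + lambda) - h x = lambda by lra.
by rewrite gtr0_norm.
Qed.

Lemma maximal_equilateral_infinite (A : set (CK K R)) :
  infinite_set [set: K] -> maximal_equilateral A -> infinite_set A.
Proof.
move=> infK [[l l0 Al] Amax] /finite_seqP[[|f s] As].
  (* The empty set is not maximal, since singletons are equilateral. *)
  apply: Amax; exists [set 0].
    by exists 1 => // x y -> ->.
  by rewrite As; split=> [x|/(_ 0 erefl)].
have [|g gP] := finite_equilateral_extend l f s infK l0.
  by move=> h k hS kS; apply: Al; rewrite As.
have Ag h : A h -> mdist g h = l by rewrite As; exact: gP.
apply: Amax; exists (g |` A).
  exists l => // x y [->|Ax] [->|Ay] // xy.
  - exact: Ag.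
  - by rewrite metric_sym; exact: Ag.
  - exact: Al.
split=> [x|/(_ g (or_introl erefl)) /Ag]; first by right.
by rewrite mdistxx => l0'; move: l0; rewrite -l0' ltxx.
Qed.

End sup_metric.

(** * Isolated points and the continuous functions they provide *)

Section compactification.
Context {R : realType} {K : compactHausdorffType} {i : nat -> K}.
Hypothesis hi : compactification_of_nat i.

Lemma compactification_inj : injective i.
Proof. by case: hi => -[]. Qed.

Lemma compactification_infinite : infinite_set [set: K].
Proof.
move=> /(finite_preimage (in2W compactification_inj)).
by rewrite preimage_setT; exact: infinite_nat.
Qed.

(** If an open [V] meets the dense copy of the naturals only in [i n], then [V] without [i n] is
    open and misses that copy, hence is empty. *)
Lemma compactification_isolated n : open [set i n].
Proof.
case: hi => -[iinj iopen] dense_i.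
have [V oV nV] := (iopen [set n]).1 (discrete_open _).
suff -> : [set i n] = V by [].
apply/seteqP; split=> [_ ->|x Vx].
  by have : [set n] n by []; rewrite nV.
apply: contrapT => xn.
have o1 : open (~` [set i n]).
  apply: closed_openC; apply: accessible_closed_set1.
  exact: hausdorff_accessible hausdorffT.
have [y [[Vy yn] [m _ my]]] :=
  dense_i _ (ex_intro _ x (conj Vx xn)) (openI oV o1).
have Vm : (i @^-1` V) m by rewrite /= my.
by rewrite -nV in Vm; apply: yn; rewrite -my Vm.
Qed.

Lemma compactification_delta n :
  exists e : CK K R, forall m, e (i m) = (m == n)%:R.
Proof.
have ce : continuous (fun x : K => (x == i n)%:R : R).
  move=> x; apply: cvg_near_cst; have [->|xn] := eqVneq x (i n).
    have := open_nbhs_nbhs (conj (compactification_isolated n) erefl).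
    by apply: filterS => _ ->; rewrite eqxx.
  have oC : open (~` [set i n]).
    apply: closed_openC; apply: accessible_closed_set1.
    exact: hausdorff_accessible hausdorffT.
  have xC : (~` [set i n]) x by exact/eqP.
  by apply: filterS (open_nbhs_nbhs (conj oC xC)) => z /eqP/negPf ->.
exists (mkCK ce) => m.
by rewrite [LHS]/((i m == i n)%:R) (inj_eq compactification_inj).
Qed.

Lemma compactification_initial n :
  exists e : CK K R, forall m, e (i m) = (m < n)%:R.
Proof.
elim: n => [|n [e eE]]; first by exists 0.
have [d dE] := compactification_delta n.
exists (e + d) => m.
have -> : CK_fun (e + d) (i m) = CK_fun e (i m) + CK_fun d (i m) by [].
rewrite eE dE ltnS.
by case: ltngtP => _; rewrite /= ?mulr0n ?addr0 ?add0r.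
Qed.

(** The index is shifted to make room for the constant [-1] as [a 0]; the function [f_n] is
    [a n.+1]. *)
Lemma compactification_stairs : exists a : nat -> CK K R,
  (forall m, a 0 (i m) = -1) /\
  forall n m, a n.+1 (i m) = (m == n)%:R - (m < n)%:R.
Proof.
have [d dE] := choice compactification_delta.
have [e eE] := choice compactification_initial.
have cN1 : continuous (fun _ : K => -1 : R) by move=> x; exact: cvg_cst.
exists (fun n => if n is n'.+1 then d n' - e n' else mkCK cN1); split=> // n m.
by rewrite -dE -eE.
Qed.

Lemma dense_nat_mdist_le (f g : CK K R) c : 0 <= c ->
  (forall m, `|f (i m) - g (i m)| <= c) -> mdist f g <= c.
Proof.
move=> c0 fgc; apply: (@CK_mdist_le_dense K R (range i)) => //.
  by case: hi.
by move=> _ [m _ <-].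
Qed.

(** * A countable maximal equilateral set *)

Section stairs.
Context {a : nat -> CK K R}.
Hypothesis a0E : forall m, a 0 (i m) = -1.
Hypothesis aSE : forall n m, a n.+1 (i m) = (m == n)%:R - (m < n)%:R.

Lemma stairs_mdist n p : (n < p)%N -> mdist (a p) (a n) = 2.
Proof.
case: p => // p np; apply/le_anti/andP; split.
  apply: dense_nat_mdist_le => // m; rewrite aSE ler_norml.
  by case: n np => [|n] np; rewrite ?a0E ?aSE; apply/andP;
    do ![case: ltngtP => _ /=]; split; lra.
(* The values [1] and [-1] meet at [i p] when one function is the constant, and otherwise at
   [i n]. *)
case: n np => [|n] np.
  apply: le_trans (CK_mdist_ub _ _ (i p)).
  by rewrite aSE a0E eqxx ltnn /= ger0_norm; lra.
apply: le_trans (CK_mdist_ub _ _ (i n)).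
rewrite !aSE eqxx ltnn (ltn_eqF (np : (n < p)%N)) (np : (n < p)%N) /= ler0_norm; lra.
Qed.

(* A function at distance [2] from all the [a n.+1] takes values in [[-1, 1]] on
   the naturals, hence by induction on [n] the value [-1] at [n]: the distance to
   [a n.+1] can only be attained there. *)
Lemma stairs_unique (g : CK K R) : (forall n, mdist g (a n) = 2) -> g = a 0.
Proof.
move=> ga; have bnd n m : `|g (i m) - a n (i m)| <= 2.
  by rewrite -(ga n); exact: CK_mdist_ub.
(* At [i m] the functions [a m.+1] and [a m.+2] are [1] and [-1], and [g] is within [2] of both. *)
have g1 m : -1 <= g (i m) <= 1.
  have := bnd m.+2 m; have := bnd m.+1 m; rewrite !aSE ltnSn eqxx ltnn.
  rewrite (ltn_eqF (ltnSn m)) /= !ler_norml => /andP[gl _] /andP[_ gu].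
  by apply/andP; split; lra.
have gE n : g (i n) = -1.
  have [k] := ubnP n; elim: k n => // k IH n nk.
  suff : 2 <= `|g (i n) - 1|.
    by have := g1 n; case: ler0P; lra.
  rewrite leNgt; apply/negP => gn.
  (* Before [n] both functions are [-1]; after [n] the second is [0] and [g] is at most [1] in
     absolute value. *)
  have : mdist g (a n.+1) <= Num.max 1 `|g (i n) - 1|.
    apply: dense_nat_mdist_le => [|m]; first by rewrite le_max ler01.
    rewrite aSE le_max; case: ltngtP => mn /=.
    - by rewrite IH ?(leq_trans mn)// ler_norml; apply/orP; left; lra.
    - by rewrite subr0 subr0 ler_norml g1.
    - by rewrite subr0 mn lexx orbT.
  by rewrite ga leNgt gt_max gn andbT ltrDl ltr01.
apply: mdist_positivity; apply/le_anti; rewrite mdist_ge0 andbT.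
by apply: dense_nat_mdist_le => // m; rewrite gE a0E subrr normr0.
Qed.

Lemma stairs_inj : injective a.
Proof.
move=> n p; case: (ltngtP n p) => // np anp; have := stairs_mdist _ _ np;
  by rewrite anp mdistxx => /esym/eqP; rewrite pnatr_eq0.
Qed.

Lemma stairs_maximal : maximal_equilateral (range a).
Proof.
split.
  exists 2 => // _ _ [n _ <-] [p _ <-] np.
  case: (ltngtP n p) => [np'|np'|np']; last by rewrite np' in np.
    by rewrite metric_sym stairs_mdist.
  by rewrite stairs_mdist.
move=> [B [l l0 Bl] [aB BaN]]; apply: BaN => g Bg.
have Ba n : B (a n) by apply: aB; exists n.
apply: contrapT => ag.
(* The common distance in [B] is already fixed by [a 0] and [a 1]. *)
have l2 : l = 2.
  rewrite -(stairs_mdist 0 1 isT) Bl//.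
  by move/stairs_inj.
suff : g = a 0 by move=> g0; apply: ag; exists 0%N.
apply: stairs_unique => n; rewrite -l2 Bl// => gn.
by apply: ag; exists n.
Qed.

End stairs.

End compactification.

Theorem theorem6 (R : realType) (K : compactHausdorffType) (i : nat -> K)
    (hi : compactification_of_nat i) :
  m_is (CK K R) [set: nat].
Proof.
split; last first.
  move=> A mA; apply/infiniteP.
  exact: maximal_equilateral_infinite (compactification_infinite hi) mA.
have [a [a0E aSE]] := @compactification_stairs R K i hi.
exists (range a); first exact (stairs_maximal hi a0E aSE).
by apply: inj_card_eq; apply: in2W; exact (stairs_inj hi a0E aSE).
Qed.
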